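(* A formula $A$ is a theorem of the intuitionistic modal logic $IK$ if and only if there is a term $t$ such that $\cdot\vdash t:A$ is derivable in the Fitch-style calculus for $IK$ (that is, $A$ is an inhabited type in the empty context).
   Context: Formulas/types: $A,B ::= p \mid 1 \mid A\times B \mid A\to B \mid 0 \mid A+B \mid \Box A$, with $p$ ranging over propositional atoms ($1,\times,\to,0,+$ read as truth, conjunction, implication, falsity, disjunction). The logic $IK$ is intuitionistic propositional logic in this language extended with the axiom K: $\Box(A\to B)\to\Box A\to\Box B$ and the rule of necessitation (if $A$ is a theorem then so is $\Box A$), closed under modus ponens. The calculus. Contexts are given by $\Gamma ::= \cdot \mid \Gamma,x:A \mid \Gamma,\bullet$, where $x$ is a variable not already in $\Gamma$ and $\bullet$ is a structural symbol called a lock. Terms: $x$, $\langle\rangle$, $\langle t,u\rangle$, $\pi_1 t$, $\pi_2 t$, $\lambda x.t$, $t\,u$, $\mathrm{inl}\,t$, $\mathrm{inr}\,t$, $\mathrm{case}\ s\ \mathrm{of}\ (x.t;\,y.u)$, $\mathrm{abort}\,t$, $\mathrm{shut}\,t$, $\mathrm{open}\,t$. Typing rules: (var) $\Gamma,x:A,\Gamma'\vdash x:A$ provided $\Gamma'$ contains no lock; (products) $\Gamma\vdash\langle\rangle:1$; from $\Gamma\vdash t:A$ and $\Gamma\vdash u:B$ infer $\Gamma\vdash\langle t,u\rangle:A\times B$; from $\Gamma\vdash t:A_1\times A_2$ infer $\Gamma\vdash\pi_i t:A_i$; (functions) from $\Gamma,x:A\vdash t:B$ infer $\Gamma\vdash\lambda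 x.t:A\to B$; from $\Gamma\vdash t:A\to B$ and $\Gamma\vdash u:A$ infer $\Gamma\vdash t\,u:B$; (sums) from $\Gamma\vdash t:A$ infer $\Gamma\vdash\mathrm{inl}\,t:A+B$; from $\Gamma\vdash t:B$ infer $\Gamma\vdash\mathrm{inr}\,t:A+B$; from $\Gamma\vdash s:A+B$, $\Gamma,x:A,\Gamma'\vdash t:C$ and $\Gamma,y:B,\Gamma'\vdash u:C$ infer $\Gamma,\Gamma'\vdash\mathrm{case}\ s\ \mathrm{of}\ (x.t;\,y.u):C$ (any $\Gamma'$); from $\Gamma\vdash t:0$ infer $\Gamma,\Gamma'\vdash\mathrm{abort}\,t:A$ (any $\Gamma'$); (shut) from $\Gamma,\bullet\vdash t:A$ infer $\Gamma\vdash\mathrm{shut}\,t:\Box A$; (open) from $\Gamma\vdash t:\Box A$ infer $\Gamma,\bullet,\Gamma'\vdash\mathrm{open}\,t:A$ provided $\Gamma'$ contains no lock. *)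

(* Defs.v *)
From mathcomp Require Import all_boot.

Set Implicit Arguments.
Unset Strict Implicit.
Unset Printing Implicit Defensive.

Inductive formula (P : Type) : Type :=
| Atom of P
| Unit
| Prod of formula P & formula P
| Arr of formula P & formula P
| Empty
| Sum of formula P & formula P
| Box of formula P.

Arguments Unit {P}.
Arguments Empty {P}.

Declare Scope formula_scope.
Delimit Scope formula_scope with F.
Bind Scope formula_scope with formula.

Notation "1" := Unit : formula_scope.
Notation "0" := Empty : formula_scope.
Notation "A * B" := (Prod A B) : formula_scope.
Notation "A + B" := (Sum A B) : formula_scope.
Notation "A ==> B" := (Arr A B) : formula_scope.
Notation "□ A" := (Box A) (at level 35, right associativity) : formula_scope.

(* A Hilbert axiomatisation of intuitionistic propositional logic.  These are
   schemes over the whole language, so instances may contain boxes. *)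
Inductive ipl_axiom (P : Type) : formula P -> Prop :=
| ax_k A B : ipl_axiom (A ==> B ==> A)
| ax_s A B C : ipl_axiom ((A ==> B ==> C) ==> (A ==> B) ==> A ==> C)
| ax_true : ipl_axiom 1
| ax_pair A B : ipl_axiom (A ==> B ==> A * B)
| ax_fst A B : ipl_axiom (A * B ==> A)
| ax_snd A B : ipl_axiom (A * B ==> B)
| ax_inl A B : ipl_axiom (A ==> A + B)
| ax_inr A B : ipl_axiom (B ==> A + B)
| ax_case A B C : ipl_axiom ((A ==> C) ==> (B ==> C) ==> A + B ==> C)
| ax_false A : ipl_axiom (0 ==> A).

Inductive IK_theorem (P : Type) : formula P -> Prop :=
| IK_ipl A : ipl_axiom A -> IK_theorem A
| IK_K A B : IK_theorem (□ (A ==> B) ==> □ A ==> □ B)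
| IK_mp A B : IK_theorem (A ==> B) -> IK_theorem A -> IK_theorem B
| IK_nec A : IK_theorem A -> IK_theorem (□ A).

Definition variable := nat.

(* Raw terms with named variables, not quotiented by alpha-equivalence. *)
Inductive term : Type :=
| tVar of variable
| tUnit
| tPair of term & term
| tFst of term
| tSnd of term
| tLam of variable & term
| tApp of term & term
| tInl of term
| tInr of term
| tCase of term & variable & term & variable & term (* case s of (x.t; y.u) *)
| tAbort of term
| tShut of term
| tOpen of term.

Inductive entry (P : Type) : Type :=
| Hyp of variable & formula P
| Lock.

Arguments Lock {P}.

(* Contexts are read from left to right: the most recent entry is last. *)
Definition context (P : Type) := seq (entry P).

Definition entry_var (P : Type) (e : entry P) : option variable :=
  if e is Hyp x _ then Some x else None.

Definition is_lock (P : Type) (e : entry P) : bool :=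
  if e is Lock then true else false.

Definition lock_free (P : Type) (G : context P) : bool := ~~ has (@is_lock P) G.

(* The proviso of the context grammar that an added variable is fresh. *)
Definition wf_context (P : Type) (G : context P) : bool :=
  uniq (pmap (@entry_var P) G).

(* Well-formedness is required exactly in the rules where it does not already
   follow from that of the premises; see typed_wf. *)
Inductive typed (P : Type) : context P -> term -> formula P -> Prop :=
| ty_var G x A G' :
    wf_context (G ++ [:: Hyp x A] ++ G') -> lock_free G' ->
    typed (G ++ [:: Hyp x A] ++ G') (tVar x) A
| ty_unit G :
    wf_context G -> typed G tUnit 1
| ty_pair G t u A B :
    typed G t A -> typed G u B -> typed G (tPair t u) (A * B)
| ty_fst G t A B :
    typed G t (A * B) -> typed G (tFst t) A
| ty_snd G t A B :
    typed G t (A * B) -> typed G (tSnd t) B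
| ty_lam G x t A B :
    typed (G ++ [:: Hyp x A]) t B -> typed G (tLam x t) (A ==> B)
| ty_app G t u A B :
    typed G t (A ==> B) -> typed G u A -> typed G (tApp t u) B
| ty_inl G t A B :
    typed G t A -> typed G (tInl t) (A + B)
| ty_inr G t A B :
    typed G t B -> typed G (tInr t) (A + B)
| ty_case G G' s x t y u A B C :
    typed G s (A + B) ->
    typed (G ++ [:: Hyp x A] ++ G') t C ->
    typed (G ++ [:: Hyp y B] ++ G') u C ->
    typed (G ++ G') (tCase s x t y u) C
| ty_abort G G' t A :
    wf_context (G ++ G') ->
    typed G t 0 -> typed (G ++ G') (tAbort t) A
| ty_shut G t A :
    typed (G ++ [:: Lock]) t A -> typed G (tShut t) (□ A)
| ty_open G G' t A :
    wf_context (G ++ [:: Lock] ++ G') -> lock_free G' ->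
    typed G t (□ A) -> typed (G ++ [:: Lock] ++ G') (tOpen t) A.

Lemma typed_wf (P : Type) (G : context P) (t : term) (A : formula P) :
  typed G t A -> wf_context G.
Proof.
elim=> {G t A} //.
- by move=> G x t A B _; rewrite /wf_context pmap_cat cat_uniq => /andP[].
- move=> G G' s x t y u A B C _ _ _ + _ _; rewrite /wf_context !pmap_cat.
  by apply: subseq_uniq; rewrite cat_subseq ?suffix_subseq.
- by move=> G t A _; rewrite /wf_context pmap_cat cats0.
Qed.

(* Main.v *)
Require Import Defs.
From mathcomp Require Import all_boot.

(** Reading a hypothesis [x : B] as [B -> _] and a lock as [Box _] turns a
    context into a normal modality of IK, under which every typing rule is
    derivable.  Conversely the axioms are inhabited by the obvious terms, and
    necessitation holds because a closed derivation may be prefixed by a lock. *)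

Set Implicit Arguments.
Unset Strict Implicit.
Unset Printing Implicit Defensive.

Definition close_entry (P : Type) (e : entry P) (A : formula P) : formula P :=
  if e is Hyp _ B then (B ==> A)%F else (□ A)%F.

Definition close (P : Type) (G : context P) (A : formula P) : formula P :=
  foldr (@close_entry P) A G.

Section Soundness.

Variable P : Type.
Implicit Types (A B C D : formula P) (G : context P).

Lemma close_cat G G' A : close (G ++ G') A = close G (close G' A).
Proof. exact: foldr_cat. Qed.

Lemma IK_weaken A B : IK_theorem A -> IK_theorem (B ==> A).
Proof. exact: IK_mp (IK_ipl (ax_k _ _)). Qed.

Lemma IK_app A B C :
  IK_theorem (A ==> B ==> C) -> IK_theorem (A ==> B) -> IK_theorem (A ==> C).
Proof. by move=> /(IK_mp (IK_ipl (ax_s _ _ _))); apply: IK_mp. Qed.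

Lemma IK_trans A B C :
  IK_theorem (A ==> B) -> IK_theorem (B ==> C) -> IK_theorem (A ==> C).
Proof. by move=> tAB /(IK_weaken A) tBC; apply: IK_app tBC tAB. Qed.

Lemma IK_id A : IK_theorem (A ==> A).
(* The combinator term S K K, with [A ==> A] as the middle formula. *)
Proof. exact: IK_app (IK_ipl (ax_k A (A ==> A))) (IK_ipl (ax_k _ _)). Qed.

Lemma IK_close_thm G A : IK_theorem A -> IK_theorem (close G A).
Proof.
by move=> tA; elim: G => //= -[x B|] G; [apply: IK_weaken | apply: IK_nec].
Qed.

(** Both kinds of layer are normal: [C ==> _] distributes over an implication by [ax_s], and the box
    by K. At each entry this is used twice, once on the induction hypothesis placed under the layer
    and once on the implication that results. *)
Lemma IK_close_K G A B :
  IK_theorem (close G (A ==> B) ==> close G A ==> close G B).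
Proof.
elim: G => [|[x C|] G IH] /=; first exact: IK_id.
- apply: IK_trans (IK_ipl (ax_s _ _ _)).
  exact: IK_mp (IK_ipl (ax_s _ _ _)) (IK_weaken C IH).
- apply: IK_trans (IK_K _ _).
  exact: IK_mp (IK_K _ _) (IK_nec IH).
Qed.

Lemma IK_close_mp G A B :
  IK_theorem (close G (A ==> B)) -> IK_theorem (close G A) ->
  IK_theorem (close G B).
Proof. by move=> /(IK_mp (IK_close_K G A B)); apply: IK_mp. Qed.

Lemma IK_close_map G A B :
  IK_theorem (A ==> B) -> IK_theorem (close G A) -> IK_theorem (close G B).
Proof. by move=> /(IK_close_thm G); apply: IK_close_mp. Qed.

(** Every layer is then an implication, which [ax_k] introduces; a lock would call for
    [A ==> □ A]. *)
Lemma IK_close_lock_free G A : lock_free G -> IK_theorem (A ==> close G A).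
Proof.
elim: G => [|[x C|] G IH] //= free_G; first exact: IK_id.
exact: IK_trans (IH free_G) (IK_ipl (ax_k _ _)).
Qed.

Lemma typed_close G t A : typed G t A -> IK_theorem (close G A).
Proof.
elim=> {G t A}.
- move=> G x A G' _ free_G'; rewrite !close_cat.
  exact/IK_close_thm/IK_close_lock_free.
- by move=> G _; apply/IK_close_thm/IK_ipl/ax_true.
- move=> G t u A B _ tA _ tB.
  by apply: IK_close_mp tB; apply: IK_close_map tA; apply/IK_ipl/ax_pair.
- by move=> G t A B _; apply/IK_close_map/IK_ipl/ax_fst.
- by move=> G t A B _; apply/IK_close_map/IK_ipl/ax_snd.
- by move=> G x t A B _; rewrite close_cat.
- by move=> G t u A B _ tAB _; apply: IK_close_mp.
- by move=> G t A B _; apply/IK_close_map/IK_ipl/ax_inl.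
- by move=> G t A B _; apply/IK_close_map/IK_ipl/ax_inr.
(* The branches close to [A ==> close G' C] and [B ==> close G' C] under [G], so [ax_case] with
   target [close G' C] eliminates the sum across any locks in [G']. *)
- move=> G G' s x t y u A B C _ tAB _ + _; rewrite !close_cat => tAC tBC.
  apply: IK_close_mp tAB; apply: IK_close_mp tBC.
  by apply: IK_close_map tAC; apply/IK_ipl/ax_case.
- move=> G G' t A _ _; rewrite close_cat.
  exact/IK_close_map/IK_ipl/ax_false.
- by move=> G t A _; rewrite close_cat.
- move=> G G' t A _ free_G' _; rewrite !close_cat.
  (* Under [G] the goal is [□ A ==> □ (close G' A)]: K applied to the necessitation of
     [A ==> close G' A]. *)
  apply: IK_close_map; apply: IK_mp (IK_K _ _) _.
  exact/IK_nec/IK_close_lock_free.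
Qed.

End Soundness.

Section Completeness.

Variable P : Type.
Implicit Types (A B C : formula P) (G : context P).

(** A leftmost lock binds no variable and never falls in the segment [G'] that must be lock-free, so
    the same term and the same rules still work. *)
Lemma typed_lock_prefix G t A : typed G t A -> typed (Lock :: G) t A.
Proof.
elim=> {G t A}.
(* [Lock :: (G ++ G')] is convertible to [(Lock :: G) ++ G'], so naming the left part lets the rule
   unify. *)
- by move=> G x A G'; apply: (@ty_var P (Lock :: G)).
- by move=> G; apply: (@ty_unit P (Lock :: G)).
- by move=> G t u A B _ tA _; apply: ty_pair.
- by move=> G t A B _; apply: ty_fst.
- by move=> G t A B _; apply: ty_snd.
- by move=> G x t A B _; apply: (@ty_lam P (Lock :: G)).
- by move=> G t u A B _ tAB _; apply: ty_app.
- by move=> G t A B _; apply: ty_inl.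
- by move=> G t A B _; apply: ty_inr.
- move=> G G' s x t y u A B C _ tAB _ tC _.
  exact: (@ty_case P (Lock :: G)) tAB tC.
- by move=> G G' t A wfG _; apply: (@ty_abort P (Lock :: G)).
- by move=> G t A _; apply: (@ty_shut P (Lock :: G)).
- by move=> G G' t A wfG free_G' _; apply: (@ty_open P (Lock :: G)).
Qed.

Lemma ipl_axiom_typed A : ipl_axiom A -> exists t, typed [::] t A.
Proof.
case=> {A}.
- move=> A B; exists (tLam 0 (tLam 1 (tVar 0))); do 2 apply: ty_lam.
  exact: (@ty_var _ [::] 0 A [:: Hyp 1 B]).
- move=> A B C; set G := [:: Hyp 0 (A ==> B ==> C)%F; Hyp 1 (A ==> B)%F].
  exists (tLam 0 (tLam 1 (tLam 2
    (tApp (tApp (tVar 0) (tVar 2)) (tApp (tVar 1) (tVar 2)))))).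
  have tA : typed (G ++ [:: Hyp 2 A]) (tVar 2) A by exact: (@ty_var _ G 2 A [::]).
  do 3 apply: ty_lam; apply: ty_app; apply: ty_app tA.
    exact: (@ty_var _ [::] 0 _ [:: Hyp 1 (A ==> B)%F; Hyp 2 A]).
  exact: (@ty_var _ [:: Hyp 0 _] 1 _ [:: Hyp 2 A]).
- by exists tUnit; apply: ty_unit.
- move=> A B; exists (tLam 0 (tLam 1 (tPair (tVar 0) (tVar 1)))).
  do 2 apply: ty_lam; apply: ty_pair.
    exact: (@ty_var _ [::] 0 A [:: Hyp 1 B]).
  exact: (@ty_var _ [:: Hyp 0 A] 1 B [::]).
- move=> A B; exists (tLam 0 (tFst (tVar 0))).
  by apply: ty_lam; apply: ty_fst; apply: (@ty_var _ [::] 0 (A * B)%F [::]).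
- move=> A B; exists (tLam 0 (tSnd (tVar 0))).
  by apply: ty_lam; apply: ty_snd; apply: (@ty_var _ [::] 0 (A * B)%F [::]).
- move=> A B; exists (tLam 0 (tInl (tVar 0))).
  by apply: ty_lam; apply: ty_inl; apply: (@ty_var _ [::] 0 A [::]).
- move=> A B; exists (tLam 0 (tInr (tVar 0))).
  by apply: ty_lam; apply: ty_inr; apply: (@ty_var _ [::] 0 B [::]).
- move=> A B C.
  set G := [:: Hyp 0 (A ==> C)%F; Hyp 1 (B ==> C)%F; Hyp 2 (A + B)%F].
  exists (tLam 0 (tLam 1 (tLam 2
    (tCase (tVar 2) 3 (tApp (tVar 0) (tVar 3)) 3 (tApp (tVar 1) (tVar 3)))))).
  (* The two branches have separate contexts, so both may bind variable 3. *)
  do 3 apply: ty_lam; apply: (@ty_case _ G [::] _ _ _ _ _ A B).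
  + exact: (@ty_var _ [:: Hyp 0 _; Hyp 1 _] 2 _ [::]).
  + apply: ty_app (@ty_var _ G 3 A [::] _ _) => //.
    exact: (@ty_var _ [::] 0 _ [:: Hyp 1 _; Hyp 2 _; Hyp 3 _]).
  + apply: ty_app (@ty_var _ G 3 B [::] _ _) => //.
    exact: (@ty_var _ [:: Hyp 0 _] 1 _ [:: Hyp 2 _; Hyp 3 _]).
- move=> A; exists (tLam 0 (tAbort (tVar 0))); apply: ty_lam.
  apply: (@ty_abort _ [:: Hyp 0 0%F] [::]) => //.
  exact: (@ty_var _ [::] 0 0%F [::]).
Qed.

(** Inside [tShut] the context ends with a lock; each [tOpen] removes it, making the boxed
    hypotheses of [G] accessible again. *)
Lemma K_typed A B : exists t, typed [::] t (□ (A ==> B) ==> □ A ==> □ B)%F.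
Proof.
set G := [:: Hyp 0 (□ (A ==> B))%F; Hyp 1 (□ A)%F].
exists (tLam 0 (tLam 1
  (tShut (tApp (tOpen (tVar 0)) (tOpen (tVar 1)))))).
do 2 apply: ty_lam; apply: ty_shut; apply: (@ty_app _ _ _ _ A).
  apply: (@ty_open _ G [::]) => //.
  exact: (@ty_var _ [::] 0 _ [:: Hyp 1 _]).
apply: (@ty_open _ G [::]) => //.
exact: (@ty_var _ [:: Hyp 0 _] 1 _ [::]).
Qed.

Lemma IK_theorem_typed A : IK_theorem A -> exists t, typed [::] t A.
Proof.
elim=> {A} [A|A B|A B _ [t tAB] _ [u tA]|A _ [t tA]].
- exact: ipl_axiom_typed.
- exact: K_typed.
- by exists (tApp t u); apply: ty_app tA.
- by exists (tShut t); apply/ty_shut/typed_lock_prefix.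
Qed.

End Completeness.

Theorem theorem1 (P : Type) (A : formula P) :
  IK_theorem A <-> exists t : term, typed [::] t A.
Proof.
by split=> [|[t /typed_close]]; first exact: IK_theorem_typed.
Qed.
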